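(* Let $F$ be a finite group, $G=F\,\mathrm{wr}\,S_\infty$ the restricted wreath product, $\Lambda$ the poset (under inclusion) of all finite subsets of $\mathbb{N}$, with $G$ acting on $\Lambda$ through its action on $\mathbb{N}$, and let $\eta:\Lambda\to\mathrm{Sub}(G)$, $\eta(\lambda)=G_\lambda$, where $G_\lambda$ is the subgroup of all elements of $G$ whose support is contained in $\lambda$. Then $(\Lambda,F\,\mathrm{wr}\,S_\infty,\eta)$ is an admissible set of data (so $\eta(\Lambda)$ is an admissible family of subgroups).
   Context: $S_\infty$ is the group of finitary permutations of $\mathbb{N}$. Elements of $F\,\mathrm{wr}\,S_\infty$ are sequences $(s;f_1,f_2,\dots)$ with $s\in S_\infty$, $f_i\in F$, all but finitely many $f_i$ equal to $e$; the product is $(s';f')(s'';f'')=(s's'';\,(f'_{s''(i)}f''_i)_{i\in\mathbb{N}})$, and $(s;f)$ acts on $\mathbb{N}$ by $s$. The support of $h=(s;f_1,f_2,\dots)$ is the finite set of all $n$ with $s(n)\neq n$ or $f_n\ne e$. Admissible poset: a poset $\Lambda$ with a minimal element $0$ (so $0\preceq\lambda$ for all $\lambda$), such that $\{\lambda'\mid\lambda'\preceq\lambda\}$ is finite for each $\lambda$ and each finite subset has a supremum. The supremum of $\lambda',\lambda''$ is denoted $\lambda'\wedge\lambda''$. Let $G$ be a group acting on $\Lambda$ by order automorphisms, let $\mathrm{Sub}(G)$ be the poset of subgroups of $G$ (ordered by inclusion, $G$ acting by conjugation), and let $\eta:\Lambda\to\mathrm{Sub}(G)$, $\lambda\mapsto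 G_\lambda$, be order preserving and $G$-equivariant ($G_{g\lambda}=gG_\lambda g^{-1}$). Put $L=\Lambda/G$. For $l',l''\in L$, $l'\wedge l''\subset L$ is the set of orbits of all elements $\lambda'\wedge\lambda''$, $\lambda'\in l'$, $\lambda''\in l''$. $G_l$ denotes the conjugacy class of the subgroups $G_\lambda$, $\lambda\in l$. A partial element is a pair $(\lambda,h)$ with $\lambda\in\Lambda$, $h\in G_\lambda$; $G$ acts on partial elements by $g(\lambda,h)=(g\lambda,ghg^{-1})$ (conjugation). $(\Lambda,G,\eta)$ (with $\eta$ order preserving and $G$-equivariant) is an admissible set of data, and $\eta(\Lambda)$ an admissible family of subgroups, if $\Lambda$ is admissible and: (1) $G_0=\{e\}$; (2) every $G_\lambda$ is finite; (3) $l'\wedge l''$ is a finite set for all $l',l''\in L$; (4) if $l'\wedge x=l''\wedge x$ for all $x\in L$ and $G_{l'}=G_{l''}$, then $l'=l''$; (5) for any $\lambda',\lambda''\preceq\lambda$, any two partial elements $(\lambda',h'),(\lambda'',h'')$ conjugated by an element of $G$ are conjugated by an element of $G_\lambda$. *)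

(* Defs.v *)
From HB Require Import structures.
From mathcomp Require Import all_boot all_order fingroup finmap.
From mathcomp Require Import boolp classical_sets functions cardinality.

Set Implicit Arguments.
Unset Strict Implicit.
Unset Printing Implicit Defensive.

Import Order.TTheory.

Local Open Scope classical_set_scope.
Local Open Scope group_scope.

Section Admissible.
Context {d : Order.disp_t} {T : bPOrderType d} {G : groupType}.
Implicit Types (act : G -> T -> T) (eta : T -> set G).

(* The minimal element 0 is [\bot]; that it lies below every element is part
   of [bPOrderType]. *)
Record admissible_poset : Prop := AdmissiblePoset {
  finite_below : forall x : T, finite_set [set y : T | (y <= x)%O];
  finite_has_lub : forall A : set T, finite_set A -> exists x, isLub A x }.

Record order_action act : Prop := OrderAction {
  order_act1 : forall x, act 1 x = x;
  order_actM : forall g h x, act (g * h) x = act g (act h x);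
  order_act_le : forall g x y, (act g x <= act g y)%O = (x <= y)%O }.

Definition is_subgroup (H : set G) : Prop :=
  [/\ H 1, forall g h, H g -> H h -> H (g * h) & forall g, H g -> H g^-1].

Definition conj_elt (g h : G) : G := g * h * g^-1.

Definition conj_set (g : G) (H : set G) : set G := conj_elt g @` H.

Record equivariant_family act eta : Prop := EquivariantFamily {
  family_subgroup : forall x, is_subgroup (eta x);
  family_homo : forall x y, (x <= y)%O -> eta x `<=` eta y;
  family_equivariant : forall g x, eta (act g x) = conj_set g (eta x) }.

Definition act_orbit act (x : T) : set T := [set act g x | g in [set: G]].

(* The quotient L of the poset by G, as a set of orbits. *)
Definition act_orbits act : set (set T) := range (act_orbit act).

(* The orbits of all suprema of an element of l1 and an element of l2; the
   supremum is usually written with the symbol of a meet in this context. *)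
Definition orbit_sup act (l1 l2 : set T) : set (set T) :=
  [set l | exists x1 x2 x,
     [/\ l1 x1, l2 x2, isLub [set x1; x2] x & l = act_orbit act x]].

Definition conj_class eta (l : set T) : set (set G) :=
  [set H | exists x g, l x /\ H = conj_set g (eta x)].

Definition partial_elt eta : set (T * G) := [set p | eta p.1 p.2].

Definition act_partial act (g : G) (p : T * G) : T * G :=
  (act g p.1, conj_elt g p.2).

Record admissible_data act eta : Prop := AdmissibleData {
  data_poset : admissible_poset;
  data_action : order_action act;
  data_family : equivariant_family act eta;
  data_bot : eta \bot%O = [set 1];
  data_finite : forall x, finite_set (eta x);
  data_sup : forall l1 l2, act_orbits act l1 -> act_orbits act l2 ->
    finite_set (orbit_sup act l1 l2);
  data_sep : forall l1 l2, act_orbits act l1 -> act_orbits act l2 ->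
    (forall l, act_orbits act l -> orbit_sup act l1 l = orbit_sup act l2 l) ->
    conj_class eta l1 = conj_class eta l2 -> l1 = l2;
  data_conj : forall x x1 x2 h1 h2, (x1 <= x)%O -> (x2 <= x)%O ->
    partial_elt eta (x1, h1) -> partial_elt eta (x2, h2) ->
    (exists g, act_partial act g (x1, h1) = (x2, h2)) ->
    exists2 g, eta x g & act_partial act g (x1, h1) = (x2, h2) }.

End Admissible.

Arguments admissible_poset {d} T.

Definition admissible_family (G : groupType) (S : set (set G)) : Prop :=
  exists (d : Order.disp_t) (T : bPOrderType d)
         (act : G -> T -> T) (eta : T -> set G),
    admissible_data act eta /\ S = range eta.

Fact fset_display : Order.disp_t. Proof. exact: Order.Disp tt tt. Qed.

Section FsetOrder.
Variable K : choiceType.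

Fact fset_le_anti : antisymmetric (@fsubset K).
Proof. by move=> A B; rewrite -eqEfsubset => /eqP. Qed.

Fact fset_le_trans : transitive (@fsubset K).
Proof. by move=> B A C; apply: fsubset_trans. Qed.

HB.instance Definition _ := Order.Le_isPOrder.Build fset_display {fset K}
  (@fsubset_refl K) fset_le_anti fset_le_trans.

HB.instance Definition _ :=
  Order.hasBottom.Build fset_display {fset K} (@fsub0set K).

Lemma fset_leE (A B : {fset K}) : (A <= B)%O = (A `<=` B)%fset.
Proof. by []. Qed.

Lemma fset_botE : \bot%O = fset0 :> {fset K}.
Proof. by []. Qed.

End FsetOrder.

(* The group of finitary permutations of nat. A term of type
   [{fsfun nat -> nat}] is a function equal to the identity outside of a
   finite set. *)
Record finperm := FinPerm {
  finperm_val :> {fsfun nat -> nat};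
  _ : `[< bijective finperm_val >] }.

HB.instance Definition _ := [isSub for finperm_val].
HB.instance Definition _ := [Choice of finperm by <:].

Section FinPermGroup.
Implicit Types s t u : finperm.

Lemma finperm_bij s : bijective s.
Proof. by case: s => s /= /asboolP. Qed.

Lemma finpermP s t : s =1 t -> s = t.
Proof. by move=> st; apply/val_inj/fsfunP. Qed.

Fact finperm_one_bij : `[< bijective ([fsfun] : {fsfun nat -> nat}) >].
Proof. by apply/asboolP; exists id => n; rewrite fsfunE. Qed.

Definition finperm_one : finperm := FinPerm finperm_one_bij.

Fact finperm_mul_bij s t : `[< bijective (fsfun_comp s t) >].
Proof.
apply/asboolP.
have /eq_bij := bij_comp (finperm_bij s) (finperm_bij t); apply=> n.
by rewrite fscompE.
Qed.

(* [finperm_mul s t] is t followed by s. *)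
Definition finperm_mul s t : finperm := FinPerm (finperm_mul_bij s t).

Fact finperm_surj s n : exists m, s m == n.
Proof. by have [t _ tK] := finperm_bij s; exists (t n); rewrite tK. Qed.

Definition finperm_preim s n : nat := xchoose (finperm_surj s n).

Lemma finperm_preimK s : cancel (finperm_preim s) s.
Proof. by move=> n; apply/eqP/(xchooseP (finperm_surj s n)). Qed.

Definition finperm_inv_val s : {fsfun nat -> nat} :=
  [fsfun n in finsupp s => finperm_preim s n].

Fact finperm_inv_valE s : finperm_inv_val s =1 finperm_preim s.
Proof.
move=> n; rewrite fsfunE; case: ifPn => // /fsfun_dflt sn.
by apply: (bij_inj (finperm_bij s)); rewrite finperm_preimK.
Qed.

Fact finperm_inv_bij s : `[< bijective (finperm_inv_val s) >].
Proof.
apply/asboolP; exists s => n; rewrite finperm_inv_valE ?finperm_preimK //.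
by apply: (bij_inj (finperm_bij s)); rewrite finperm_preimK.
Qed.

Definition finperm_inv s : finperm := FinPerm (finperm_inv_bij s).

Lemma finperm_oneE n : finperm_one n = n.
Proof. exact: fsfun0E. Qed.

Lemma finperm_mulE s t n : finperm_mul s t n = s (t n).
Proof. exact: fscompE. Qed.

Lemma finperm_invKr s n : s (finperm_inv s n) = n.
Proof. by rewrite [finperm_inv s n]finperm_inv_valE finperm_preimK. Qed.

Lemma finperm_invKl s n : finperm_inv s (s n) = n.
Proof. by apply: (bij_inj (finperm_bij s)); rewrite finperm_invKr. Qed.

Fact finperm_mulA : associative finperm_mul.
Proof. by move=> s t u; apply: finpermP => n; rewrite !finperm_mulE. Qed.

Fact finperm_1mul : left_id finperm_one finperm_mul.
Proof. by move=> s; apply: finpermP => n; rewrite finperm_mulE finperm_oneE. Qed.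

Fact finperm_mul1 : right_id finperm_one finperm_mul.
Proof. by move=> s; apply: finpermP => n; rewrite finperm_mulE finperm_oneE. Qed.

Fact finperm_Vmul : left_inverse finperm_one finperm_inv finperm_mul.
Proof.
by move=> s; apply: finpermP => n; rewrite finperm_mulE finperm_invKl finperm_oneE.
Qed.

Fact finperm_mulV : right_inverse finperm_one finperm_inv finperm_mul.
Proof.
by move=> s; apply: finpermP => n; rewrite finperm_mulE finperm_invKr finperm_oneE.
Qed.

HB.instance Definition _ := isGroup.Build finperm
  finperm_mulA finperm_1mul finperm_mul1 finperm_Vmul finperm_mulV.

Lemma finperm1E n : (1 : finperm) n = n.
Proof. exact: finperm_oneE. Qed.

Lemma finpermME s t n : (s * t) n = s (t n).
Proof. exact: finperm_mulE. Qed.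

Lemma finpermKV s n : s (s^-1 n) = n.
Proof. exact: finperm_invKr. Qed.

Lemma finpermK s n : s^-1 (s n) = n.
Proof. exact: finperm_invKl. Qed.

End FinPermGroup.

(* The restricted wreath product of F with the finitary permutations of nat:
   [(s; f_0, f_1, ...)] with f_n = 1 outside of a finite set. *)
Record wreath (F : finGroupType) := Wreath {
  wperm : finperm;
  wfun : {fsfun nat -> F with 1} }.

Section WreathGroup.
Variable F : finGroupType.
Implicit Types g h k : wreath F.

Fact wreath_pairK :
  cancel (fun h => (wperm h, wfun h)) (fun p => @Wreath F p.1 p.2).
Proof. by case. Qed.

HB.instance Definition _ := Choice.copy (wreath F) (can_type wreath_pairK).

Lemma wreathP g h : wperm g = wperm h -> wfun g =1 wfun h -> g = h.
Proof. by case: g h => [s f] [t f'] /= -> /fsfunP ->. Qed.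

Definition wreath_one : wreath F := Wreath 1 [fsfun].

Definition wreath_mul g h : wreath F :=
  Wreath (wperm g * wperm h)
    [fsfun n in (finsupp (wperm h) `|` finsupp (wfun g) `|` finsupp (wfun h))%fset
       => wfun g (wperm h n) * wfun h n].

Definition wreath_inv g : wreath F :=
  Wreath (wperm g)^-1
    [fsfun n in (finsupp (wperm g)^-1 `|` finsupp (wfun g))%fset
       => (wfun g ((wperm g)^-1 n))^-1].

Lemma wreath_oneE n : wfun wreath_one n = 1.
Proof. exact: fsfun0E. Qed.

Lemma wreath_mulE g h n :
  wfun (wreath_mul g h) n = wfun g (wperm h n) * wfun h n.
Proof.
rewrite fsfunE !inE; case: ifPn => //; rewrite !negb_or -andbA.
case/and3P=> /fsfun_dflt-> /fsfun_dflt-> /fsfun_dflt->.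
by rewrite mulg1.
Qed.

Lemma wreath_invE g n : wfun (wreath_inv g) n = (wfun g ((wperm g)^-1 n))^-1.
Proof.
rewrite fsfunE !inE; case: ifPn => //; rewrite !negb_or.
by case/andP=> /fsfun_dflt-> /fsfun_dflt->; rewrite invg1.
Qed.

Fact wreath_mulA : associative wreath_mul.
Proof.
move=> g h k; apply: wreathP => [|n]; first exact: mulgA.
by rewrite !wreath_mulE /= finpermME mulgA.
Qed.

Fact wreath_1mul : left_id wreath_one wreath_mul.
Proof.
move=> g; apply: wreathP => [|n]; first exact: mul1g.
by rewrite wreath_mulE wreath_oneE mul1g.
Qed.

Fact wreath_mul1 : right_id wreath_one wreath_mul.
Proof.
move=> g; apply: wreathP => [|n]; first exact: mulg1.
by rewrite wreath_mulE wreath_oneE mulg1 /= finperm1E.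
Qed.

Fact wreath_Vmul : left_inverse wreath_one wreath_inv wreath_mul.
Proof.
move=> g; apply: wreathP => [|n]; first exact: mulVg.
by rewrite wreath_mulE wreath_invE wreath_oneE finpermK mulVg.
Qed.

Fact wreath_mulV : right_inverse wreath_one wreath_inv wreath_mul.
Proof.
move=> g; apply: wreathP => [|n]; first exact: mulgV.
by rewrite wreath_mulE wreath_invE wreath_oneE /= mulgV.
Qed.

HB.instance Definition _ := isGroup.Build (wreath F)
  wreath_mulA wreath_1mul wreath_mul1 wreath_Vmul wreath_mulV.

Lemma wreathME g h n : wfun (g * h) n = wfun g (wperm h n) * wfun h n.
Proof. exact: wreath_mulE. Qed.

Definition wsupp h : {fset nat} :=
  (finsupp (wperm h) `|` finsupp (wfun h))%fset.

Lemma in_wsupp h n : (n \in wsupp h) = (wperm h n != n) || (wfun h n != 1).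
Proof. by rewrite inE !mem_finsupp. Qed.

Definition wreath_act h (A : {fset nat}) : {fset nat} :=
  [fset wperm h n | n in A]%fset.

Definition wreath_sub (A : {fset nat}) : set (wreath F) :=
  [set h | (wsupp h `<=` A)%fset].

End WreathGroup.

(* Main.v *)
(** A partial injection between subsets of a finite set [A] extends to a
permutation supported in [A].  Extending the restriction of [g] to the first
set of a partial element, and cutting its [F]-components off outside of that
set, moves a conjugator into the subgroup attached to [A].  It also shows that
an orbit of finite sets is given by a cardinality, and the cardinality of a
union is bounded.  Since the orbit of the empty set is neutral for the join of
orbits, this join alone already separates orbits. *)

Require Import Defs.
From mathcomp Require Import all_boot all_order fingroup finmap.
From mathcomp Require Import boolp classical_sets functions cardinality.

Import Order.TTheory.

Local Open Scope classical_set_scope.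
Local Open Scope group_scope.

(** * Finitary permutations with prescribed values *)

Lemma finperm_inj (s : finperm) : injective s.
Proof. exact: bij_inj (finperm_bij s). Qed.

Lemma finperm_swap (a b : nat) : exists s : finperm,
  [/\ s a = b, s b = a & forall n, n != a -> n != b -> s n = n].
Proof.
pose v : {fsfun nat -> nat} :=
  [fsfun n in [fset a; b]%fset => if n == a then b else a].
have vE n : v n = if n == a then b else if n == b then a else n.
  by rewrite fsfunE !inE; case: eqP => //=; case: eqP.
have vK : involutive v.
  move=> n; rewrite !vE; case: (n =P a) => [->|/eqP na].
    by rewrite eqxx; case: eqP.
  case: (n =P b) => [->|/eqP nb]; first by rewrite eqxx.
  by rewrite (negbTE na) (negbTE nb).
have vbij : `[< bijective v >] by apply/asboolP; exists v.
exists (FinPerm vbij); split=> [||n na nb] /=; rewrite vE ?eqxx //.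
  by case: eqP.
by rewrite (negbTE na) (negbTE nb).
Qed.

(** If [s n] lay outside [A], then [s] would fix [s n], and injectivity would give [s n = n]. *)
Lemma finperm_stable (s : finperm) (A : {fset nat}) :
  (forall n, n \notin A -> s n = n) -> forall n, n \in A -> s n \in A.
Proof.
move=> sA n nA; apply: contraLR (nA) => sn.
by rewrite -(finperm_inj s _ _ (sA _ sn)).
Qed.

(** Induction on [r]: the permutation found for the tail is followed by a transposition that
    corrects its value at the head. *)
Lemma finperm_extend (f : nat -> nat) (r : seq nat) (A : {fset nat}) :
    uniq r -> {in r &, injective f} -> {subset r <= A} ->
    (forall n, n \in r -> f n \in A) ->
  exists s : finperm, {in r, s =1 f} /\ (forall n, n \notin A -> s n = n).
Proof.
elim: r => [|a r IH] /= => [_ _ _ _|/andP[ar ur] finj rA fA].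
  by exists 1; split=> // n _; rewrite finperm1E.
have sub_r n : n \in r -> n \in a :: r by rewrite inE orbC => ->.
have [|||s [sf sA]] := IH ur.
- by move=> m n /sub_r mr /sub_r nr; apply: finj.
- by move=> n /sub_r/rA.
- by move=> n /sub_r/fA.
have aA : a \in A by rewrite rA ?mem_head.
have faA : f a \in A by rewrite fA ?mem_head.
(* The values already right survive: for [n] in [r], [f n = s n] differs from [s a] by injectivity
   of [s], and from [f a] by that of [f]. Both swapped points lie in [A]. *)
have [t [tsa _ tid]] := finperm_swap (s a) (f a).
exists (t * s); split=> [n|n nA]; rewrite finpermME.
  rewrite inE => /predU1P[->//|nr].
  have na : n != a by apply: contraNneq ar => <-.
  rewrite -(sf _ nr) tid // ?(inj_eq (finperm_inj s)) // sf //.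
  by rewrite (inj_in_eq finj) ?mem_head ?sub_r.
rewrite sA // tid //; apply: contraNneq nA => -> //.
exact: finperm_stable.
Qed.

Section Wreath.
Variable F : finGroupType.
Implicit Types (g h : wreath F) (A B : {fset nat}) (n : nat).

(** * Supports, the action on finite sets, and the subgroups attached to them *)

Lemma wperm1E n : wperm (1 : wreath F) n = n.
Proof. exact: finperm1E. Qed.

Lemma wpermME g h n : wperm (g * h) n = wperm g (wperm h n).
Proof. exact: finpermME. Qed.

Lemma wpermVK g n : wperm g^-1 (wperm g n) = n.
Proof. exact: finpermK. Qed.

Lemma wpermKV g n : wperm g (wperm g^-1 n) = n.
Proof. exact: finpermKV. Qed.

Lemma wfun1E n : wfun (1 : wreath F) n = 1.
Proof. exact: wreath_oneE. Qed.

Lemma wreath_subP A h :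
  wreath_sub A h <-> forall n, n \notin A -> wperm h n = n /\ wfun h n = 1.
Proof.
split=> [/fsubsetP hA n | hA].
  move/(contra (hA n)); rewrite in_wsupp negb_or !negbK.
  by case/andP=> /eqP-> /eqP->.
apply/fsubsetP=> n; rewrite in_wsupp; apply: contraTT => /hA[-> ->].
by rewrite !eqxx.
Qed.

Lemma wreath_sub_stable A h n : wreath_sub A h -> n \in A -> wperm h n \in A.
Proof. by move/wreath_subP=> hA; apply: finperm_stable => m /hA[]. Qed.

Lemma wreath_sub_subgroup A : is_subgroup (wreath_sub A : set (wreath F)).
Proof.
split.
- by apply/wreath_subP => n _; rewrite wperm1E wfun1E.
- move=> g h /wreath_subP gA /wreath_subP hA; apply/wreath_subP => n nA.
  by rewrite wpermME wreathME; case: (hA n nA) => -> ->; case: (gA n nA) => -> ->;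
     rewrite mulg1.
- move=> g /wreath_subP gA; apply/wreath_subP => n nA.
  have [gn fn] := gA n nA.
  have gVn : wperm g^-1 n = n by rewrite -{1}gn wpermVK.
  by rewrite [wfun _ _]wreath_invE [(wperm g)^-1 n]gVn fn invg1.
Qed.

Lemma wreath_sub0 : wreath_sub fset0 = [set (1 : wreath F)].
Proof.
apply/seteqP; split=> [h /wreath_subP h0|_ ->]; last first.
  by case: (wreath_sub_subgroup fset0).
apply: wreathP => [|n]; first apply: finpermP => n.
  by rewrite wperm1E; case: (h0 n).
by rewrite wfun1E; case: (h0 n).
Qed.

Lemma mem_wreath_act g A n : (wperm g n \in wreath_act g A) = (n \in A).
Proof. by rewrite mem_imfset //; apply: finperm_inj. Qed.

Lemma wreath_actP g A n : (n \in wreath_act g A) = (wperm g^-1 n \in A).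
Proof. by rewrite -[in LHS](wpermKV g n) mem_wreath_act. Qed.

Lemma wreath_act1 A : wreath_act (1 : wreath F) A = A.
Proof.
by apply/fsetP => n; rewrite -[in LHS](wperm1E n) mem_wreath_act.
Qed.

Lemma wreath_actM g h A : wreath_act (g * h) A = wreath_act g (wreath_act h A).
Proof. by apply/fsetP => n; rewrite !wreath_actP invgM wpermME. Qed.

Lemma wreath_act_le g A B :
  (wreath_act g A <= wreath_act g B)%O = (A <= B)%O.
Proof.
apply/fsubsetP/fsubsetP => AB n.
  by rewrite -(mem_wreath_act g) => /AB; rewrite mem_wreath_act.
by rewrite !wreath_actP => /AB.
Qed.

Lemma wreath_order_action : order_action (@wreath_act F).
Proof.
by split; [exact: wreath_act1|exact: wreath_actM|exact: wreath_act_le].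
Qed.

Lemma wreath_sub_conj g h A :
  wreath_sub A h -> wreath_sub (wreath_act g A) (conj_elt g h).
Proof.
move/wreath_subP=> hA; apply/wreath_subP => n; rewrite wreath_actP => /hA[hn fn].
split; first by rewrite !wpermME hn wpermKV.
(* As [h] is trivial at [wperm g^-1 n], the component at [n] is that of [g * g^-1]. *)
by rewrite !wreathME hn fn mulg1 -wreathME mulgV wfun1E.
Qed.

Lemma wreath_equivariant : equivariant_family (@wreath_act F) (@wreath_sub F).
Proof.
split=> [A|A B AB h|g A]; first exact: wreath_sub_subgroup.
  by move=> hA; apply: fsubset_trans AB.
apply/seteqP; split=> [h hA|_ [h hA <-]]; last exact: wreath_sub_conj.
(* The preimage lies in the subgroup of [A] by the same lemma, applied to [g^-1]. *)
exists (conj_elt g^-1 h).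
  by rewrite -(wreath_act1 A) -(mulVg g) wreath_actM; apply: wreath_sub_conj.
by rewrite /conj_elt invgK !mulgA mulgV mul1g -mulgA mulgV mulg1.
Qed.

Lemma finite_wreath_sub A : finite_set (wreath_sub A : set (wreath F)).
Proof.
(* An element supported in [A] is determined by its restriction to [A], a point of a finite type.
   The option makes [f] total; on the subgroup [insub] always succeeds, since [A] is stable. *)
pose f h := ([ffun n : A => insub (wperm h (val n)) : option A],
             [ffun n : A => wfun h (val n)]).
have finj : {in (wreath_sub A : set (wreath F)) &, injective f}.
  move=> g h; rewrite !inE => gA hA [/ffunP egh /ffunP efgh].
  have gA' := (wreath_subP _ _).1 gA; have hA' := (wreath_subP _ _).1 hA.
  apply: wreathP => [|n]; first apply: finpermP => n.
    have [nA|nA] := boolP (n \in A); last by rewrite (gA' _ nA).1 (hA' _ nA).1.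
    have := egh [` nA]%fset; rewrite !ffunE /=.
    by rewrite !insubT ?wreath_sub_stable // => ? ? [].
  have [nA|nA] := boolP (n \in A); last by rewrite (gA' _ nA).2 (hA' _ nA).2.
  by have := efgh [` nA]%fset; rewrite !ffunE.
rewrite -(eq_finite_set (inj_card_eq finj)).
exact: finite_finset.
Qed.

(** * Conjugation of partial elements *)

Lemma wreath_conj A B C h k :
    (B <= A)%O -> (C <= A)%O -> wreath_sub B h -> wreath_sub C k ->
    (exists g, act_partial (@wreath_act F) g (B, h) = (C, k)) ->
  exists2 g, wreath_sub A g & act_partial (@wreath_act F) g (B, h) = (C, k).
Proof.
move=> /fsubsetP BA /fsubsetP CA hB kC [g [gB gh]].
have gBC n : (wperm g n \in C) = (n \in B) by rewrite -gB mem_wreath_act.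
have [||||s [sg sA]] := @finperm_extend (wperm g) (enum_fset B) A.
- exact: fset_uniq.
- by move=> m n _ _; apply: finperm_inj.
- by move=> n nB; apply: BA.
- by move=> n nB; apply: CA; rewrite gBC.
(* [s] agrees with [g] on [B], which [g] maps onto [C]; so [s] sends the complement of [B] into that
   of [C]. *)
have sBC n : (s n \in C) = (n \in B).
  apply/idP/idP => [snC|nB]; last by rewrite sg ?gBC.
  have gnB : wperm g^-1 (s n) \in B by rewrite -gBC wpermKV.
  rewrite -(_ : wperm g^-1 (s n) = n) //.
  by apply: (finperm_inj s); rewrite sg // wpermKV.
pose g' : wreath F := Wreath s [fsfun n in B => wfun g n].
have g'E n : wfun g' n = if n \in B then wfun g n else 1 by rewrite fsfunE.
exists g'.
  apply/wreath_subP => n nA; split; first exact: sA.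
  by rewrite g'E ifN //; apply: contra nA; apply: BA.
congr (_, _).
  by rewrite /= -gB; apply: eq_in_imfset.
(* It remains to see that [g' * h = k * g']. On [B], which [h] preserves, this is the same identity
   for [g]; off [B], [h] is trivial at [n] and [k] at [s n]. *)
rewrite /= /conj_elt; apply: (canLR (mulgK g')).
have gh' : g * h = k * g by rewrite -gh /conj_elt -mulgA mulVg mulg1.
have hB' := (wreath_subP _ _).1 hB; have kC' := (wreath_subP _ _).1 kC.
apply: wreathP => [|n]; first apply: finpermP => n.
  rewrite !wpermME /=; have [nB|nB] := boolP (n \in B).
    by rewrite !sg ?wreath_sub_stable // -!wpermME gh'.
  by rewrite (hB' _ nB).1 (kC' _ _).1 // sBC.
rewrite !wreathME !g'E; have [nB|nB] := boolP (n \in B).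
  by rewrite wreath_sub_stable // [wperm g' n]sg // -!wreathME gh'.
by rewrite (hB' _ nB).1 (hB' _ nB).2 (negbTE nB) (kC' _ _).2 // sBC.
Qed.

(** * Orbits of finite sets and their joins *)

Lemma wreath_orbitE A B g :
  wreath_act g A = B ->
  act_orbit (@wreath_act F) A = act_orbit (@wreath_act F) B.
Proof.
move=> <-; apply/seteqP; split=> _ [h _ <-].
  by exists (h * g^-1); rewrite // -wreath_actM -mulgA mulVg mulg1.
by exists (h * g); rewrite // wreath_actM.
Qed.

(** The chosen representative of the orbit of sets with [m] elements. *)
Definition initial_fset (m : nat) : {fset nat} := [fset n in iota 0 m]%fset.

Lemma wreath_act_initial A : exists g, wreath_act g A = initial_fset #|` A|.
Proof.
pose f n := index n (enum_fset A).
have f_lt n : (f n < #|` A|)%N = (n \in A) by rewrite index_mem.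
have [||||s [sf _]] := @finperm_extend f (enum_fset A)
    (A `|` initial_fset #|` A|)%fset.
- exact: fset_uniq.
- by move=> m n mA nA; apply: index_inj.
- by move=> n nA; rewrite !inE nA.
- by move=> n nA; rewrite !inE /= mem_iota add0n f_lt nA orbT.
exists (Wreath s [fsfun]); apply/fsetP => n; rewrite !inE /= mem_iota add0n.
apply/imfsetP/idP => [[m mA ->]|nA] /=; first by rewrite sf ?f_lt.
exists (nth 0%N (enum_fset A) n); first by rewrite mem_nth.
by rewrite sf ?mem_nth // /f index_uniq // fset_uniq.
Qed.

Lemma isLub_fsetU A B C : isLub [set A; B] C -> C = (A `|` B)%fset.
Proof.
case=> CU Cmin; apply/eqP; rewrite eqEfsubset fsubUset.
rewrite [(A `<=` C)%fset]CU ?[(B `<=` C)%fset]CU; [|by right|by left].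
rewrite !andbT [(C `<=` _)%fset]Cmin // => _ [] ->;
  by rewrite fset_leE ?fsubsetUl ?fsubsetUr.
Qed.

Lemma fsetU_isLub A B : isLub [set A; B] (A `|` B)%fset.
Proof.
split=> [_ [] ->|C CU]; rewrite fset_leE ?fsubsetUl ?fsubsetUr //.
by rewrite fsubUset -!fset_leE !CU //; [right|left].
Qed.

Lemma card_wreath_act g A : #|` wreath_act g A| = #|` A|.
Proof. by rewrite card_imfset //; apply: finperm_inj. Qed.

Lemma finite_orbit_sup A B :
  finite_set (orbit_sup (@wreath_act F) (act_orbit (@wreath_act F) A)
                                        (act_orbit (@wreath_act F) B)).
Proof.
pose orb m := act_orbit (@wreath_act F) (initial_fset m).
(* The successor admits the size [#|] A| + #|[B|], reached by disjoint translates. *)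
apply: (@sub_finite_set _ _ (orb @` `I_(#|` A| + #|` B|).+1)); last first.
  exact/finite_image/finite_II.
move=> _ [_ [_ [_ [[g _ <-] [h _ <-] /isLub_fsetU-> ->]]]].
set C := (_ `|` _)%fset; have [k kC] := wreath_act_initial C.
exists #|` C|; last by rewrite /orb (wreath_orbitE _ _ _ kC).
by rewrite /= ltnS cardfsU (leq_trans (leq_subr _ _)) // !card_wreath_act.
Qed.

(** Every translate of [fset0] is empty, so the unions formed are just the translates of [A]. *)
Lemma orbit_sup0 A :
  orbit_sup (@wreath_act F) (act_orbit (@wreath_act F) A)
    (act_orbit (@wreath_act F) fset0) = [set act_orbit (@wreath_act F) A].
Proof.
apply/seteqP; split=> [_ [_ [_ [_ [[g _ <-] [h _ <-] /isLub_fsetU-> ->]]]]|_ ->].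
  by rewrite [wreath_act h _]imfset0 fsetU0; apply/esym/wreath_orbitE.
exists A, fset0, A; split=> //.
- by exists 1; rewrite ?wreath_act1.
- by exists 1; rewrite ?wreath_act1.
- by rewrite -{2}(fsetU0 A); apply: fsetU_isLub.
Qed.

Lemma fset_admissible (K : choiceType) : admissible_poset {fset K}.
Proof.
split=> [A|S].
  apply: sub_finite_set (finite_fset (fpowerset A)) => B.
  by rewrite /= fpowersetE.
case/finite_seqP=> r ->; exists (\bigcup_(B <- r) B)%fset; split=> [B|C] /= Br.
  exact: bigfcup_sup.
by apply/bigfcupsP => B /Br.
Qed.

Lemma wreath_admissible_data : admissible_data (@wreath_act F) (@wreath_sub F).
Proof.
split.
- exact: fset_admissible.
- exact: wreath_order_action.
- exact: wreath_equivariant.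
- exact: wreath_sub0.
- exact: finite_wreath_sub.
- by move=> _ _ [A _ <-] [B _ <-]; apply: finite_orbit_sup.
(* Tested on the orbit of [fset0], the two joins are singletons, and their equality identifies the
   orbits. *)
- move=> _ _ [A _ <-] [B _ <-] /(_ (act_orbit (@wreath_act F) fset0)).
  rewrite !orbit_sup0 => eqAB _.
  suff : [set act_orbit (@wreath_act F) B] (act_orbit (@wreath_act F) A) by [].
  by rewrite -eqAB //; exists fset0.
- by move=> A B C h k BA CA; apply: wreath_conj.
Qed.

End Wreath.

Theorem theorem2p2 (F : finGroupType) :
  admissible_data (@wreath_act F) (@wreath_sub F) /\
  admissible_family (range (@wreath_sub F)).
Proof.
have data := wreath_admissible_data F; split=> //.
by exists fset_display, {fset nat}, (@wreath_act F), (@wreath_sub F).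
Qed.
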